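(* Let $\mathbb{F}_q$ be a finite field, and let $\mathcal{R}=|U_{(1,1,1)}|^2e_{U_{(1,1,1)}}e_{U_{(1,1,1)}^{op}}e_{U_{(1,1,1)}}$ be the Radon element for $GL_3(\mathbb{F}_q)$ and $\lambda=(1,1,1)$. Then $\mathcal{R}$ lies in $\mathcal{H}(GL_3(\mathbb{F}_q),U_{(1,1,1)})\subset\mathcal{H}(GL_3(\mathbb{F}_q),U_{(2,1)})$, so that it acts on $\mathbb{C}[GL_3(\mathbb{F}_q)/U_{(2,1)}]$ by right multiplication, and the eigenvalues of this action form a subset of $\{0,1,q,q^2,q^3,q^4,q^5,q^6\}$.
   Context: For a tuple $\mu$ of positive integers with sum $3$, $U_\mu\subset GL_3(\mathbb{F}_q)$ is the group of block upper triangular matrices whose diagonal blocks are identity matrices of sizes given by $\mu$, and $U_\mu^{op}$ is the group of transposes. For a subgroup $H$ of a finite group $G$, $e_H=\frac{1}{|H|}\sum_{h\in H}h\in\mathbb{C}[G]$; $\mathbb{C}[G/H]=\mathbb{C}[G]e_H$ is the space of right $H$-invariant elements; and $\mathcal{H}(G,H)=e_H\mathbb{C}[G]e_H$ is the Hecke algebra, with unit $e_H$, which acts on $\mathbb{C}[G/H]$ by right multiplication. *)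

(* Defs.v *)
From HB Require Import structures.
From mathcomp Require Import all_boot all_order all_algebra all_fingroup all_field.
From mathcomp Require Import complex reals.
Set Implicit Arguments.
Unset Strict Implicit.
Unset Printing Implicit Defensive.
Import GRing.Theory.
Local Open Scope ring_scope.

Definition group_algebra (K : fieldType) (gT : finGroupType) : Type :=
  {ffun gT -> K^o}.

Section GroupAlgebra.
Variables (K : fieldType) (gT : finGroupType).
Local Notation A := (group_algebra K gT).

HB.instance Definition _ := Vector.copy A {ffun gT -> K^o}.

Definition galg_basis (g : gT) : A := [ffun x => (x == g)%:R].

Definition galg_mul (a b : A) : A :=
  [ffun x => \sum_(y : gT) (a y : K) * (b (y^-1 * x)%g : K)].

Fact galg_mulA : associative galg_mul.
Proof.
move=> a b c; apply/ffunP=> x; rewrite !ffunE.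
under eq_bigr => y _ do rewrite ffunE mulr_sumr.
under [RHS]eq_bigr => y _ do rewrite ffunE mulr_suml.
rewrite exchange_big [RHS]exchange_big [LHS]exchange_big /=.
apply: eq_bigr => y _.
rewrite (reindex_inj (mulgI y^-1%g)) /=; apply: eq_bigr => z _.
by rewrite mulrA invMg invgK -mulgA mulKVg.
Qed.

Fact galg_mul1l : left_id (galg_basis 1%g) galg_mul.
Proof.
move=> a; apply/ffunP=> x; rewrite !ffunE (bigD1 1%g) //= ffunE eqxx mul1r.
rewrite invg1 mul1g big1 ?addr0 // => y /negbTE ny.
by rewrite ffunE ny mul0r.
Qed.

Fact galg_mul1r : right_id (galg_basis 1%g) galg_mul.
Proof.
move=> a; apply/ffunP=> x; rewrite !ffunE (bigD1 x) //= ffunE mulVg eqxx mulr1.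
rewrite big1 ?addr0 // => y /negbTE ny.
rewrite ffunE -[1%g](mulVg y) (inj_eq (mulgI _)) eq_sym ny.
by rewrite mulr0.
Qed.

Fact galg_mulDl : left_distributive galg_mul +%R.
Proof.
move=> a b c; apply/ffunP=> x; rewrite !ffunE -big_split /=.
by apply: eq_bigr => y _; rewrite ffunE mulrDl.
Qed.

Fact galg_mulDr : right_distributive galg_mul +%R.
Proof.
move=> a b c; apply/ffunP=> x; rewrite !ffunE -big_split /=.
by apply: eq_bigr => y _; rewrite ffunE mulrDr.
Qed.

Fact galg_1neq0 : galg_basis 1%g != 0.
Proof.
by apply/eqP=> /ffunP/(_ 1%g)/eqP; rewrite !ffunE eqxx oner_eq0.
Qed.

HB.instance Definition _ := GRing.Zmodule_isNzRing.Build A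
  galg_mulA galg_mul1l galg_mul1r galg_mulDl galg_mulDr galg_1neq0.

Fact galg_scaleAl (k : K) (a b : A) : k *: (a * b) = (k *: a) * b.
Proof.
apply/ffunP=> x; rewrite !ffunE scaler_sumr; apply: eq_bigr => y _.
by rewrite ffunE; apply: mulrA.
Qed.
HB.instance Definition _ := GRing.Lmodule_isLalgebra.Build K A galg_scaleAl.

Fact galg_scaleAr (k : K) (a b : A) : k *: (a * b) = a * (k *: b).
Proof.
apply/ffunP=> x; rewrite !ffunE scaler_sumr; apply: eq_bigr => y _.
by rewrite ffunE; apply: mulrCA.
Qed.
HB.instance Definition _ := GRing.Lalgebra_isAlgebra.Build K A galg_scaleAr.

HB.instance Definition _ := Algebra_isFalgebra.Build K A.

Fact galg_basisM (g h : gT) : galg_basis (g * h) = galg_basis g * galg_basis h.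
Proof.
apply/ffunP=> x; rewrite !ffunE (bigD1 g) //= !ffunE eqxx mul1r big1 ?addr0.
  by rewrite (can2_eq (mulKVg g) (mulKg g)).
by move=> y /negbTE ny; rewrite ffunE ny mul0r.
Qed.

(* Idempotent only when #|H| is invertible in K. *)
Definition averaging_idempotent (H : {group gT}) : A :=
  #|H|%:R^-1 *: \sum_(h in H) galg_basis h.

Definition invariants (H : {group gT}) : {vspace A} :=
  (fullv * <[averaging_idempotent H]>)%VS.

Definition hecke_algebra (H : {group gT}) : {vspace A} :=
  (<[averaging_idempotent H]> * fullv * <[averaging_idempotent H]>)%VS.

End GroupAlgebra.

(* The projection [vsproj W] is harmless only when W is stable under right
   multiplication by x; see [right_actionE]. *)
Definition right_action (K : fieldType) (A : falgType K) (W : {vspace A})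
    (x : A) : 'End(subvs_of W) :=
  (linfun (vsproj W) \o amulr x \o linfun vsval)%VF.

Fact right_actionE (K : fieldType) (A : falgType K) (W : {vspace A}) (x : A)
    (u : subvs_of W) :
  (forall v, v \in W -> v * x \in W) ->
  vsval (right_action W x u) = vsval u * x.
Proof.
move=> stW; rewrite /right_action !comp_lfunE !lfunE /= vsprojK //.
by apply: stW; apply: subvsP.
Qed.

Section BlockUnipotent.
Variables (F : finFieldType) (mu : seq nat).

(* [reshape_index mu i] is the number of the block of mu containing row (or
   column) i, so the condition below fixes the entries on and below the block
   diagonal. It is meant for compositions mu of 3. *)
Definition block_unipotent (M : 'M[F]_3) : bool :=
  [forall i : 'I_3, forall j : 'I_3,
    (reshape_index mu j <= reshape_index mu i)%N ==> (M i j == (i == j)%:R)].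

Fact block_unipotentP (M : 'M[F]_3) :
  reflect (forall i j : 'I_3, (reshape_index mu j <= reshape_index mu i)%N ->
             M i j = (i == j)%:R) (block_unipotent M).
Proof.
apply: (iffP forallP) => [h i j ij|h i].
  by move/forallP: (h i) => /(_ j)/implyP/(_ ij)/eqP.
by apply/forallP=> j; apply/implyP=> /h->.
Qed.

Fact block_unipotent1 : block_unipotent 1%:M.
Proof. by apply/block_unipotentP=> i j _; rewrite mxE. Qed.

Fact block_unipotentM (M N : 'M[F]_3) :
  block_unipotent M -> block_unipotent N -> block_unipotent (M *m N).
Proof.
move=> /block_unipotentP hM /block_unipotentP hN.
apply/block_unipotentP=> i j ij; rewrite mxE (bigD1 i) //= hM // eqxx mul1r.
rewrite hN // big1 ?addr0 // => k /negbTE ki.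
have [kli|ilk] := leqP (reshape_index mu k) (reshape_index mu i).
  by rewrite hM // eq_sym ki mul0r.
rewrite (hN k j) ?(leq_trans ij) ?(ltnW ilk) //.
case: eqP => [kj|_]; last by rewrite mulr0.
by rewrite kj ltnNge ij in ilk.
Qed.

Definition U_set : {set {'GL_3[F]}} := [set g : {'GL_3[F]} | block_unipotent (GLval g)].
Definition Uop_set : {set {'GL_3[F]}} :=
  [set g : {'GL_3[F]} | block_unipotent (GLval g)^T].

Fact U_group_set : group_set U_set.
Proof.
apply/group_setP; split=> [|g h]; rewrite !inE; first exact: block_unipotent1.
exact: block_unipotentM.
Qed.

Fact Uop_group_set : group_set Uop_set.
Proof.
apply/group_setP; split=> [|g h]; rewrite !inE.
  by rewrite GL_1E trmx1; apply: block_unipotent1.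
by move=> hg hh; rewrite GL_MxE trmx_mul; apply: block_unipotentM.
Qed.

Definition U : {group {'GL_3[F]}} := Group U_group_set.
Definition Uop : {group {'GL_3[F]}} := Group Uop_group_set.

End BlockUnipotent.

Definition radon_element (F : finFieldType) (K : fieldType) :
    group_algebra K {'GL_3[F]} :=
  let lambda := [:: 1; 1; 1]%N in
  let e := averaging_idempotent K (U F lambda) in
  let eop := averaging_idempotent K (Uop F lambda) in
  (#|U F lambda|%:R ^+ 2) *: (e * eop * e).

(* Main.v *)
Require Import Defs.
From mathcomp Require Import all_boot all_order all_algebra all_fingroup all_field.
From mathcomp Require Import complex reals.
From mathcomp Require Import ring.
Set Implicit Arguments.
Unset Strict Implicit.
Unset Printing Implicit Defensive.
Import Order.TTheory GRing.Theory Num.Theory.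
Local Open Scope ring_scope.

(** Write [e] for the average over the group [U] of upper unitriangular
    matrices, [n_1], [n_2] for representatives in SL_3 of the simple
    reflections, [T_i = q e n_i e] and [T_i' = q e n_i^-1 e]. The longest element
    [w = n_1 n_2 n_1] conjugates [U] to [U^op] and lengths add up in this word, so
    the Radon element, which is [q^6 e w e w^-1 e], factors as
      [T_1 T_2 T_1 T_1' T_2' T_1']
    (lemma [radon_full_twist]): it is the full twist of the Yokonuma-Hecke algebra
    [e K[G] e]. Its right multiplication maps into [K[G] e], so an eigenvector [u]
    for an eigenvalue [a != 0] satisfies [u e = u], whatever space of invariants
    it was taken from, and the problem is to bound the spectrum of the full twist.

    The braid relation is complemented by the quadratic one,
      [T_i T_i' = q e + (q - 1) E_i T_i],
    where [E_i] is the average over the coroot torus of the i-th simple root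
    ([hecke_gen_quadratic], a computation in GL_2). Let [E_3] be the analogous
    average for the highest root. The three idempotents commute with one another
    and with the Radon element, the [T_i] permute them as the simple reflections
    permute the roots, and the product of any two of them is the same. Hence [u]
    may be replaced by one of its images so that one of these cases holds.
    - All three [E] fix [u]. The [T_i] then act through the Hecke algebra of S_3,
      where the full twist is [q^3] plus a combination of [x], the sum of the
      [T_w], and of [y], its alternating analogue
      ([full_twist_decomposition]). If [u x != 0] then [a = q^6], if [u y != 0]
      then [a = 1], and otherwise [a = q^3].
    - Exactly one [E] fixes [u] and the other two kill it. All but one of the
      three quadratic relations met in the full twist degenerate to
      [T_i T_i' = q], and what remains is the Hecke algebra of S_2, giving
      [a = q^4] or [a = q^2].
    - All three [E] kill [u]. Then every relation degenerates and [a = q^3].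
    The conclusion is [full_twist_spectrum]. *)

(** * Linear combinations and eigenvalues *)

(** Applying an arbitrary linear form turns an identity between linear
    combinations of vectors into one between scalars. *)
Lemma scalar_form_ext (K : fieldType) (V : vectType K) (u v : V) :
  (forall phi : {scalar V}, phi u = phi v) -> u = v.
Proof.
move=> uv; rewrite (coord_vbasis (memvf u)) (coord_vbasis (memvf v)).
by apply: eq_bigr => i _; rewrite uv.
Qed.

Ltac linear_comb :=
  apply: scalar_form_ext => ?; rewrite !(linearE, linearZ) /=; ring.

Lemma scalar_eigen_uniq {K : fieldType} {V : lmodType K} {u : V} {a b : K} :
  u != 0 -> a *: u = b *: u -> a = b.
Proof.
move=> u0 /eqP; rewrite -subr_eq0 -scalerBl scaler_eq0 (negbTE u0) orbF.
by rewrite subr_eq0 => /eqP.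
Qed.

(** * Hecke algebras of ranks one and two *)

Section Hecke.
Variables (K : fieldType) (A : falgType K) (q : K).
Implicit Types (a : K) (u v : A).

(** The quadratic relation says that [u + u t] is an eigenvector of [t] for [q],
    unless it vanishes and [u] is one for [-1]. *)
Lemma rank_one_eigenvalue (t : A) a u :
    u * t * t = q *: u + (q - 1) *: (u * t) ->
    a *: u = q ^+ 2 *: (q *: u + (q - 1) *: (u * t)) -> u != 0 ->
  a = q ^+ 4 \/ a = q ^+ 2.
Proof.
move=> quad au u0.
have aut : a *: (u * t) =
    q ^+ 2 *: (q *: (u * t) + (q - 1) *: (q *: u + (q - 1) *: (u * t))).
  by rewrite -quad scalerAl au -!scalerAl mulrDl -!scalerAl.
have [w0|w0] := eqVneq (u + u * t) 0.
  right; apply: (scalar_eigen_uniq u0); rewrite au.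
  by rewrite (_ : u * t = - u); [linear_comb | rewrite -[LHS](addKr u) w0 addr0].
left; apply: (scalar_eigen_uniq w0).
by rewrite scalerDr au aut; linear_comb.
Qed.

Section RankTwo.
Variables (e t1 t2 : A).
Hypotheses (et1 : e * t1 = t1) (et2 : e * t2 = t2)
  (te1 : t1 * e = t1) (te2 : t2 * e = t2)
  (sq1 : t1 * t1 = q *: e + (q - 1) *: t1)
  (sq2 : t2 * t2 = q *: e + (q - 1) *: t2)
  (braid : t1 * t2 * t1 = t2 * t1 * t2).

(** [trivial_sum] and [sign_sum] span the two one-dimensional representations
    of the Hecke algebra of S_3, where both generators act by [q], respectively
    by [-1]. *)
Definition trivial_sum : A := e + t1 + t2 + t1 * t2 + t2 * t1 + t1 * t2 * t1.
Definition sign_sum : A := q ^+ 3 *: e - q ^+ 2 *: t1 - q ^+ 2 *: t2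
  + q *: (t1 * t2) + q *: (t2 * t1) - t1 * t2 * t1.

Let sq1r (u : A) : u * t1 * t1 = q *: (u * e) + (q - 1) *: (u * t1).
Proof. by rewrite -mulrA sq1 mulrDr -!scalerAr. Qed.
Let sq2r (u : A) : u * t2 * t2 = q *: (u * e) + (q - 1) *: (u * t2).
Proof. by rewrite -mulrA sq2 mulrDr -!scalerAr. Qed.
Let te1r (u : A) : u * t1 * e = u * t1. Proof. by rewrite -mulrA te1. Qed.
Let te2r (u : A) : u * t2 * e = u * t2. Proof. by rewrite -mulrA te2. Qed.

Ltac expand := rewrite ?(mulrDl, mulrDr, mulNr, mulrN, =^~ scalerAl, =^~ scalerAr) ?mulrA.
Ltac reduce := rewrite ?(et1, et2, te1, te2, te1r, te2r, sq1, sq2, sq1r, sq2r).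

Lemma t1_trivial_sum : t1 * trivial_sum = q *: trivial_sum.
Proof. by rewrite /trivial_sum; expand; reduce; expand; reduce; linear_comb. Qed.
Lemma t2_trivial_sum : t2 * trivial_sum = q *: trivial_sum.
Proof. by rewrite /trivial_sum braid; expand; reduce; expand; reduce; linear_comb. Qed.
Lemma t1_sign_sum : t1 * sign_sum = - sign_sum.
Proof. by rewrite /sign_sum; expand; reduce; expand; reduce; linear_comb. Qed.
Lemma t2_sign_sum : t2 * sign_sum = - sign_sum.
Proof. by rewrite /sign_sum braid; expand; reduce; expand; reduce; linear_comb. Qed.

Let r : A := t1 * t2 * t1 * t1 * t2 * t1.

(** On the two-dimensional representation of the Hecke algebra of S_3 the full
    twist is the scalar [q^3], so [r - q^3 e] lies in the ideal spanned by
    [trivial_sum] and [sign_sum]; the coefficients, which have denominator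
    [q + 1], come from comparing those of [e] and [t1]. *)
Lemma full_twist_decomposition :
  (q + 1) *: r =
  (q + 1) *: (q ^+ 3 *: e) + (q ^+ 3 * (q - 1)) *: trivial_sum
  - (q - 1) *: sign_sum.
Proof.
have -> : r = q *: (t1 * t2 * t2 * t1) + (q - 1) *: (t2 * t1 * t2 * t2 * t1).
  rewrite /r -!mulrA !(mulrA t1 t1) sq1 !(mulrDl, mulrDr) -!(scalerAl, scalerAr).
  by rewrite !mulrA te2r braid.
rewrite /trivial_sum /sign_sum.
do 3![expand; reduce]; rewrite -?braid sq1r te2r.
linear_comb.
Qed.

Hypotheses (q1 : q + 1 != 0).

Lemma full_twist_eigenvalue a u :
  u * e = u -> a *: u = u * r -> u != 0 -> [\/ a = 1, a = q ^+ 3 | a = q ^+ 6].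
Proof.
move=> ue au u0.
(* Since [r * x = b ^+ 6 *: x], the vector [u * x] is an eigenvector for both
   [a] and [b ^+ 6]. *)
have character (x : A) b : t1 * x = b *: x -> t2 * x = b *: x ->
    u * x != 0 -> a = b ^+ 6.
  move=> t1x t2x ux0; apply: (scalar_eigen_uniq ux0).
  rewrite scalerAl au /r -!mulrA.
  by do 6!rewrite ?t1x ?t2x -?scalerAr; rewrite !scalerA !exprSr expr0 mul1r.
have [ux|/(character _ _ t1_trivial_sum t2_trivial_sum)->] :=
  eqVneq (u * trivial_sum) 0; last by constructor 3.
have [uy|uy] := eqVneq (u * sign_sum) 0; last first.
  constructor 1; rewrite (character _ (- 1) _ _ uy) ?scaleN1r ?t1_sign_sum //.
    by rewrite -signr_odd.
  exact: t2_sign_sum.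
constructor 2; apply: (scalar_eigen_uniq u0); apply: (scalerI q1).
rewrite au scalerAr full_twist_decomposition.
by rewrite mulrBr mulrDr -!scalerAr ux uy ue !scaler0 subr0 addr0.
Qed.

End RankTwo.

(** * The full twist of a Yokonuma-Hecke algebra *)

(** The simple roots are indexed by [bool], so that [~~ i] is the simple root
    other than [i]; [E3] goes with the highest root, which each simple reflection
    exchanges with the other simple root. [T' i] is not the inverse of [T i]: it is the
    same double coset operator for the inverse representative. *)
Record yokonuma_relations (e : A) (T T' E : bool -> A) (E3 : A) : Prop :=
  YokonumaRelations {
  yk_ee : e * e = e;
  yk_eT : forall i, e * T i = T i;
  yk_Te : forall i, T i * e = T i;
  yk_Ee : forall i, E i * e = e * E i;
  yk_E3e : E3 * e = e * E3;
  yk_EE : forall i, E i * E i = E i;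
  yk_E3E3 : E3 * E3 = E3;
  yk_EC : forall i, E i * E (~~ i) = E (~~ i) * E i;
  yk_EE3 : forall i, E i * E3 = E i * E (~~ i);
  yk_E3E : forall i, E3 * E i = E i * E (~~ i);
  yk_TE : forall i, T i * E i = E i * T i;
  yk_TEn : forall i, T i * E (~~ i) = E3 * T i;
  yk_TE3 : forall i, T i * E3 = E (~~ i) * T i;
  yk_ET' : forall i, E i * T' i = E i * T i;
  yk_TT' : forall i, T i * T' i = q *: e + (q - 1) *: (E i * T i);
  yk_T'T : forall i, T' i * T i = T i * T' i;
  yk_braid : forall i,
    T i * T (~~ i) * T i = T (~~ i) * T i * T (~~ i);
  yk_braid' : forall i,
    T' i * T' (~~ i) * T' i = T' (~~ i) * T' i * T' (~~ i) }.

Section Yokonuma.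
Variables (e : A) (T T' E : bool -> A) (E3 : A).
Hypothesis yk : yokonuma_relations e T T' E E3.
Implicit Types i : bool.

Definition full_twist : A :=
  T false * T true * T false * (T' false * T' true * T' false).

(** By the braid relations the full twist has two symmetric expressions; each
    case below uses the one that starts with the convenient root. *)
Lemma full_twistE i :
  full_twist = T i * T (~~ i) * T i * T' i * T' (~~ i) * T' i.
Proof.
rewrite /full_twist; case: i => /=; last by rewrite !mulrA.
by rewrite (yk_braid yk false) (yk_braid' yk false) /= !mulrA.
Qed.

(* A product [T i * T' i] met while evaluating [u * full_twist] is a scalar when
   the vector reached so far is killed by [E i] ([step0]), and is linear in
   [T i] when it is fixed by [E i] ([step1]). *)
Let step0 u i : u * e = u -> u * E i = 0 -> u * T i * T' i = q *: u.
Proof.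
move=> ue uE; rewrite -mulrA (yk_TT' yk) mulrDr -!scalerAr mulrA uE ue.
by rewrite mul0r scaler0 addr0.
Qed.

Let step1 u i : u * e = u -> u * E i = u ->
  u * T i * T' i = q *: u + (q - 1) *: (u * T i).
Proof.
by move=> ue uE; rewrite -mulrA (yk_TT' yk) mulrDr -!scalerAr mulrA uE ue.
Qed.

Let sq_fixed u i : u * e = u -> u * E i = u ->
  u * T i * T i = q *: u + (q - 1) *: (u * T i).
Proof.
move=> ue uE; rewrite -step1 //.
by rewrite -{1}uE -!mulrA (mulrA (E i)) -(yk_TE yk) -mulrA -(yk_ET' yk) !mulrA
  -(mulrA u) (yk_TE yk) mulrA uE.
Qed.

Let Te u i : u * T i * e = u * T i.
Proof. by rewrite -mulrA (yk_Te yk). Qed.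

(** Moving [E] leftwards past the [T] permutes it among the three idempotents,
    which all kill [u]; so each of the three products [T i * T' i] contributes a
    factor [q]. *)
Lemma full_twist_regular a u :
    u * e = u -> u != 0 -> a *: u = u * full_twist ->
    u * E false = 0 -> u * E true = 0 -> u * E3 = 0 ->
  a = q ^+ 3.
Proof.
move=> ue u0 au uE1 uE2 uE3; apply: (scalar_eigen_uniq u0).
rewrite au (full_twistE false) !mulrA step0 ?Te //=; last first.
  by rewrite -mulrA (yk_TEn yk true) mulrA -(mulrA u) (yk_TE3 yk) mulrA uE2 !mul0r.
rewrite -!scalerAl step0 ?Te //=; last first.
  by rewrite -mulrA (yk_TEn yk false) mulrA uE3 mul0r.
by rewrite -scalerAl step0 //; linear_comb.
Qed.

(** Only the outermost product [T i * T' i] meets the idempotent that fixes [u];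
    the inner ones meet the other two and contribute [q] each. *)
Lemma full_twist_simple a u i :
    u * e = u -> u != 0 -> a *: u = u * full_twist ->
    u * E i = u -> u * E (~~ i) = 0 -> u * E3 = 0 ->
  a = q ^+ 4 \/ a = q ^+ 2.
Proof.
move=> ue u0 au uE1 uE2 uE3.
apply: (@rank_one_eigenvalue (T i) _ u) => //; first exact: sq_fixed.
rewrite au (full_twistE i) !mulrA step0 ?Te //=; last first.
  have := yk_TEn yk (~~ i); rewrite negbK => TE.
  by rewrite -mulrA TE mulrA -(mulrA u) (yk_TE3 yk) mulrA uE2 !mul0r.
rewrite -!scalerAl step0 ?Te //=; last first.
  by rewrite -mulrA (yk_TEn yk) mulrA uE3 mul0r.
by rewrite -scalerAl step1 //; linear_comb.
Qed.

Hypothesis q0 : q != 0.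

(** The idempotent [E3] fixing [u] is met by the middle product only. Replacing
    [u] by [u * T false] moves it to a simple root and reduces to the rank-one
    computation; this vector is nonzero since [T' false] takes it back to
    [q *: u]. *)
Lemma full_twist_highest a u :
    u * e = u -> u != 0 -> a *: u = u * full_twist ->
    u * E false = 0 -> u * E true = 0 -> u * E3 = u ->
  a = q ^+ 4 \/ a = q ^+ 2.
Proof.
move=> ue u0 au uE1 uE2 uE3.
pose w := u * T false.
have we : w * e = w by rewrite Te.
have wE1 : w * E false = 0 by rewrite -mulrA (yk_TE yk) mulrA uE1 mul0r.
have wE2 : w * E true = w.
  by rewrite -mulrA (yk_TEn yk false) mulrA uE3.
have wE3 : w * E3 = 0 by rewrite -mulrA (yk_TE3 yk) mulrA uE2 mul0r.
have T'T x : x * e = x -> x * E false = 0 -> x * T' false * T false = q *: x.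
  by move=> xe xE; rewrite -mulrA (yk_T'T yk) mulrA step0.
have wT' : w * T' false = q *: u by rewrite step0.
have w0 : w != 0.
  by apply: contraNneq u0 => w0; move/eqP: wT'; rewrite w0 mul0r eq_sym scaler_eq0
    (negbTE q0).
apply: (@rank_one_eigenvalue (T true) _ w) => //; first exact: sq_fixed.
have wTE : w * T true * E false = 0.
  by rewrite -mulrA (yk_TEn yk true) mulrA wE3 mul0r.
rewrite scalerAl au (full_twistE false) /= !mulrA -/w step0 ?Te //.
rewrite -!scalerAl step1 // mulrDl -scalerAl mulrDl -!scalerAl.
rewrite !T'T ?Te //.
linear_comb.
Qed.

(** On vectors fixed by all three idempotents [T' i] and [T i] coincide, so that
    with [e0] the product of the idempotents and of [e], the elements [T i * e0]
    satisfy the relations of the Hecke algebra of S_3. *)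
Lemma full_twist_unipotent a u :
    q + 1 != 0 ->
    u * e = u -> u != 0 -> a *: u = u * full_twist ->
    u * E false = u -> u * E true = u ->
  [\/ a = 1, a = q ^+ 3 | a = q ^+ 6].
Proof.
move=> q1 ue u0 au uE1 uE2.
pose e0 := E false * E true * e; pose t i := T i * e0.
have E12 i : E i * E (~~ i) = E false * E true.
  by case: i => //; apply: (yk_EC yk true).
have e0E i : E i * e0 = e0.
  by rewrite /e0 -(E12 i) !mulrA (yk_EE yk).
have eE : e * (E false * E true) = E false * E true * e.
  by rewrite mulrA -(yk_Ee yk) -!mulrA -(yk_Ee yk).
have e0e0 : e0 * e0 = e0.
  by rewrite {1}/e0 -mulrA (_ : e * e0 = e0) -?mulrA ?e0E // /e0 mulrA eE -mulrA (yk_ee yk).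
have Te0 i : T i * e0 = e0 * T i.
  rewrite /e0 -(E12 i) !mulrA (yk_TE yk) -(mulrA (E i)) (yk_TEn yk) mulrA (yk_EE3 yk).
  by rewrite -!mulrA (yk_Te yk) (yk_eT yk).
have T'e0 i : e0 * T' i = e0 * T i.
  have -> : e0 = e * E (~~ i) * E i by rewrite /e0 -eE -(E12 i) (yk_EC yk) mulrA.
  by rewrite -!mulrA (yk_ET' yk).
have e0t i : e0 * t i = t i by rewrite /t mulrA -Te0 -mulrA e0e0.
have te0 i : t i * e0 = t i by rewrite /t -mulrA e0e0.
have ue0 : u * e0 = u by rewrite /e0 !mulrA uE1 uE2 ue.
(* [e0] can be carried along a word in the [T] and [T'], turning each [T'] into
   [T]. *)
have push X i : X * e0 * T i = X * T i * e0 by rewrite -(mulrA X e0) -Te0 mulrA.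
have push' X i : X * e0 * T' i = X * T i * e0 by rewrite -(mulrA X e0) T'e0 mulrA push.
have pusht X i : X * e0 * t i = X * T i * e0.
  by rewrite /t mulrA push -(mulrA _ e0) e0e0.
have e0e : e0 * e = e0 by rewrite /e0 -(mulrA _ e e) (yk_ee yk).
have e0Er i : e0 * E i = e0.
  rewrite /e0 -(E12 i) (yk_EC yk) -(mulrA _ e) -(yk_Ee yk) mulrA.
  by rewrite -(mulrA _ (E i) (E i)) (yk_EE yk).
have tt i : t i * t i = q *: e0 + (q - 1) *: t i.
  rewrite {1}/t pusht -push' Te0 -mulrA (yk_TT' yk) mulrDr -!scalerAr mulrA.
  by rewrite e0Er -Te0 e0e.
have bt : t false * t true * t false = t true * t false * t true.
  by rewrite {1}/t {2}/t !pusht (yk_braid yk false).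
have au0 : a *: u = u * (t false * t true * t false * t false * t true * t false).
  rewrite au (full_twistE false) /= {1}/t !pusht !mulrA -{1}ue0.
  by rewrite !push !push' /e0 !mulrA.
exact: (full_twist_eigenvalue (e0t false) (e0t true) (te0 false) (te0 true)
  (tt false) (tt true) bt q1 ue0 au0 u0).
Qed.

Lemma full_twist_spectrum a u :
    q + 1 != 0 ->
    (forall i, full_twist * E i = E i * full_twist) ->
    full_twist * E3 = E3 * full_twist ->
    u * e = u -> u != 0 -> a *: u = u * full_twist ->
  a \in [:: 1; q ^+ 2; q ^+ 3; q ^+ 4; q ^+ 6].
Proof.
move=> q1 RE RE3 ue u0 au; rewrite !inE.
have [E0u|uE0] := eqVneq (u * (E false * E true)) 0; last first.
  case: (@full_twist_unipotent a (u * (E false * E true))) => // [||||->|->|->];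
    rewrite ?eqxx ?orbT //.
  - by rewrite -!mulrA (yk_Ee yk) (mulrA (E false)) (yk_Ee yk) !mulrA ue.
  - rewrite scalerAl au -(mulrA u full_twist) (mulrA full_twist) RE.
    by rewrite -(mulrA (E false) full_twist) RE !mulrA.
  - by rewrite (yk_EC yk false) -!mulrA (yk_EE yk).
  - by rewrite -!mulrA (yk_EE yk).
have uEn i : u * E i * E (~~ i) = 0.
  by rewrite -mulrA; case: i; rewrite //= -(yk_EC yk false).
have uEi3 i : u * E i * E3 = 0 by rewrite -mulrA (yk_EE3 yk) mulrA uEn.
have uE3i i : u * E3 * E i = 0 by rewrite -mulrA (yk_E3E yk) mulrA uEn.
have simple i : u * E i != 0 -> a = q ^+ 4 \/ a = q ^+ 2.
  move=> uE; apply: (@full_twist_simple a (u * E i) i) => //.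
  - by rewrite -mulrA (yk_Ee yk) mulrA ue.
  - by rewrite scalerAl au -(mulrA u full_twist) RE mulrA.
  - by rewrite -mulrA (yk_EE yk).
have [uE1|/simple[]->] := eqVneq (u * E false) 0; rewrite ?eqxx ?orbT //.
have [uE2|/simple[]->] := eqVneq (u * E true) 0; rewrite ?eqxx ?orbT //.
have [uE3|uE3] := eqVneq (u * E3) 0.
  by rewrite (@full_twist_regular a u) // eqxx ?orbT.
case: (@full_twist_highest a (u * E3)) => // [|||->|->]; rewrite ?eqxx ?orbT //.
- by rewrite -mulrA (yk_E3e yk) mulrA ue.
- by rewrite scalerAl au -(mulrA u full_twist) RE3 mulrA.
- by rewrite -mulrA (yk_E3E3 yk).
Qed.

End Yokonuma.
End Hecke.

(** * Averages and double cosets in a group algebra *)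

Section Averages.
Variables (K : numFieldType) (gT : finGroupType).
Local Notation A := (group_algebra K gT).
Local Notation "\b g" := (galg_basis K g%g : A) (at level 10, g at level 8).
Local Notation e H := (averaging_idempotent K H : A).
Implicit Types (G H : {group gT}) (g h m n : gT).

Lemma basisM_eq g m n : g = (m * n)%g -> \b g = \b m * \b n.
Proof. by move=> ->; apply: galg_basisM. Qed.

Lemma basis_move g h h' : (g * h = h' * g)%g -> \b g * \b h = \b h' * \b g.
Proof. by move=> gh; rewrite -!galg_basisM gh. Qed.

Lemma basis_mulV g : \b g * \b g^-1 = 1.
Proof. by rewrite -galg_basisM mulgV. Qed.

Lemma basis_average H h : h \in H -> \b h * e H = e H.
Proof.
move=> hH; rewrite /averaging_idempotent -scalerAr mulr_sumr; congr (_ *: _).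
rewrite [RHS](reindex_inj (mulgI h)) /=.
by apply: eq_big => [g|g _]; [rewrite groupMl | rewrite galg_basisM].
Qed.

Lemma average_basis H h : h \in H -> e H * \b h = e H.
Proof.
move=> hH; rewrite /averaging_idempotent -scalerAl mulr_suml; congr (_ *: _).
rewrite [RHS](reindex_inj (mulIg h)) /=.
by apply: eq_big => [g|g _]; [rewrite groupMr | rewrite galg_basisM].
Qed.

Lemma average_const H (x : A) : #|H|%:R^-1 *: (\sum_(h in H) x) = x.
Proof.
rewrite sumr_const -scaler_nat scalerA mulVf ?scale1r //.
by rewrite pnatr_eq0 -lt0n cardG_gt0.
Qed.

Lemma average_absorbl G H : H \subset G -> e H * e G = e G.
Proof.
move=> /subsetP sHG; rewrite {1}/averaging_idempotent -scalerAl mulr_suml.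
rewrite -[RHS](average_const H); congr (_ *: _).
by apply: eq_bigr => h /sHG hG; rewrite basis_average.
Qed.

Lemma average_absorbr G H : H \subset G -> e G * e H = e G.
Proof.
move=> /subsetP sHG; rewrite {2}/averaging_idempotent -scalerAr mulr_sumr.
rewrite -[RHS](average_const H); congr (_ *: _).
by apply: eq_bigr => h /sHG hG; rewrite average_basis.
Qed.

Lemma average_expand H (x y : A) :
  x * e H * y = #|H|%:R^-1 *: \sum_(h in H) x * \b h * y.
Proof.
by rewrite /averaging_idempotent -scalerAr -scalerAl mulr_sumr mulr_suml.
Qed.

Lemma average_conj G H g :
  (forall h, (h \in H) = (g * h * g^-1 \in G)%g) -> \b g * e H = e G * \b g.
Proof.
move=> HG.
have cardHG : #|H| = #|G|.
  rewrite -(cardJg H g^-1%g); apply: eq_card => h.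
  by rewrite mem_conjg invgK HG conjgE !mulgA mulgV mul1g mulgK.
rewrite /averaging_idempotent -scalerAr -scalerAl mulr_sumr mulr_suml cardHG.
congr (_ *: _); rewrite [RHS](reindex_inj (conjg_inj g^-1%g)) /=.
have cE h : (h ^ g^-1 = g * h * g^-1)%g by rewrite conjgE invgK mulgA.
apply: eq_big => [h|h _]; first by rewrite cE.
by rewrite -!galg_basisM cE mulgKV.
Qed.

Definition double_coset H g : A := e H * \b g * e H.
Local Notation D := double_coset.

Lemma double_coset_mem H h : h \in H -> D H h = e H.
Proof. by move=> hH; rewrite /D average_basis // average_absorbl. Qed.

Lemma double_coset_shift H w1 w2 g :
  w1 \in H -> w2 \in H -> D H (w1 * g * w2)%g = D H g.
Proof.
move=> h1 h2; rewrite /D !galg_basisM -!mulrA basis_average // !mulrA.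
by rewrite average_basis.
Qed.

Lemma double_cosetM_sum H m n :
  D H m * D H n = #|H|%:R^-1 *: \sum_(h in H) D H (m * h * n)%g.
Proof.
rewrite /D !mulrA -(mulrA _ (e H) (e H)) average_absorbl //.
rewrite -(mulrA _ (\b n)) average_expand; congr (_ *: _).
by apply: eq_bigr => h _; rewrite !galg_basisM !mulrA.
Qed.

(** The analogue for [H] of the condition that the lengths of two Weyl group
    elements add up: the product of the double cosets of [m] and [n] is a single
    double coset. *)
Definition additive_lengths H m n :=
  forall h, h \in H -> exists w1 w2,
    [/\ w1 \in H, w2 \in H & (m * h * n = w1 * (m * n) * w2)%g].

Lemma double_cosetM H m n : additive_lengths H m n -> D H m * D H n = D H (m * n)%g.
Proof.
move=> mn; rewrite double_cosetM_sum -[RHS](average_const H); congr (_ *: _).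
by apply: eq_bigr => h /mn[w1 [w2 [h1 h2 ->]]]; rewrite double_coset_shift.
Qed.

Lemma additive_lengthsV H m n :
  additive_lengths H m n -> additive_lengths H n^-1%g m^-1%g.
Proof.
move=> mn h; rewrite -groupV => /mn[w1 [w2 [h1 h2 E]]].
exists w2^-1%g, w1^-1%g; split; rewrite ?groupV //.
by apply: (can_inj invgK); rewrite !invMg !invgK !mulgA in E *; rewrite E.
Qed.

Lemma double_coset_mull H t g :
  \b t * e H = e H * \b t -> D H (t * g)%g = \b t * D H g.
Proof. by move=> te; rewrite /D galg_basisM !mulrA te. Qed.

Lemma double_coset_word H m n w :
    additive_lengths H m n -> additive_lengths H (m * n)%g m -> w = (m * n * m)%g ->
  D H m * D H n * D H m = D H w.
Proof. by move=> mn mnm ->; rewrite !double_cosetM. Qed.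

Lemma double_coset_wordV H m n w :
    additive_lengths H m n -> additive_lengths H (m * n)%g m -> w = (m * n * m)%g ->
  D H m^-1%g * D H n^-1%g * D H m^-1%g = D H w^-1%g.
Proof.
move=> /additive_lengthsV mn /additive_lengthsV mnm ->.
by rewrite -mulrA (double_cosetM mn) -invMg (double_cosetM mnm) -invMg.
Qed.

End Averages.

(** * Explicit elements of GL_3 *)

(** As a named group, so that the group operations are those of the general
    theory of averages. *)
Definition GL3 (F : finFieldType) : finGroupType := {'GL_3[F]}.

Section GL3.
Variable F : finFieldType.
Local Notation G := (GL3 F).
Local Notation U := (U F [:: 1; 1; 1]%N : {group G}).
Local Notation Uop := (Uop F [:: 1; 1; 1]%N : {group G}).
Local Notation q := #|F|.

Definition mx3 (a b c d e f g h i : F) : 'M[F]_3 :=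
  \matrix_(r < 3, s < 3)
    nth 0 (nth [::] [:: [:: a; b; c]; [:: d; e; f]; [:: g; h; i]] r) s.

Lemma mx3_eta (M : 'M[F]_3) : exists a b c d e f g h i, M = mx3 a b c d e f g h i.
Proof.
pose o (k : nat) : 'I_3 := inord k.
exists (M (o 0) (o 0)), (M (o 0) (o 1)), (M (o 0) (o 2)),
  (M (o 1) (o 0)), (M (o 1) (o 1)), (M (o 1) (o 2)),
  (M (o 2) (o 0)), (M (o 2) (o 1)), (M (o 2) (o 2)).
apply/matrixP => r s; rewrite mxE -{1}(inord_val r) -{1}(inord_val s).
by move: r s => [[|[|[|?]]] ?] [[|[|[|?]]] ?].
Qed.

Lemma mx3M a b c d e f g h i a' b' c' d' e' f' g' h' i' :
  mx3 a b c d e f g h i *m mx3 a' b' c' d' e' f' g' h' i' =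
  mx3 (a * a' + b * d' + c * g') (a * b' + b * e' + c * h') (a * c' + b * f' + c * i')
      (d * a' + e * d' + f * g') (d * b' + e * e' + f * h') (d * c' + e * f' + f * i')
      (g * a' + h * d' + i * g') (g * b' + h * e' + i * h') (g * c' + h * f' + i * i').
Proof.
apply/matrixP => r s; rewrite !mxE !big_ord_recl big_ord0 !mxE /=.
by move: r s => [[|[|[|?]]] ?] [[|[|[|?]]] ?] //=; rewrite addr0 addrA.
Qed.

Lemma mx3_1 : mx3 1 0 0 0 1 0 0 0 1 = 1%:M.
Proof.
apply/matrixP => r s; rewrite !mxE.
by move: r s => [[|[|[|?]]] ?] [[|[|[|?]]] ?].
Qed.

Lemma GL3_M (g h : G) : GLval (g * h)%g = GLval g *m GLval h.
Proof. exact: GL_MxE. Qed.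

Lemma GL3_1 : GLval (1%g : G) = mx3 1 0 0 0 1 0 0 0 1.
Proof. by rewrite mx3_1. Qed.

(** Total for convenience: a singular matrix is sent to [1]. *)
Definition gl3 (M : 'M[F]_3) : G := insubd (1%g : G) M.

Lemma gl3K (M N : 'M[F]_3) : M *m N = 1%:M -> GLval (gl3 M) = M.
Proof. by move=> /mulmx1_unit[uM _]; apply: insubdK. Qed.

Definition upper (a b c : F) := gl3 (mx3 1 a b 0 1 c 0 0 1).
Definition diag3 (x y z : F) := gl3 (mx3 x 0 0 0 y 0 0 0 z).
Definition refl (i : bool) :=
  gl3 (if i then mx3 1 0 0 0 0 (-1) 0 1 0 else mx3 0 (-1) 0 1 0 0 0 0 1).

Arguments upper (a b c)%_R.
Arguments diag3 (x y z)%_R.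

Lemma upperE a b c : GLval (upper a b c) = mx3 1 a b 0 1 c 0 0 1.
Proof.
apply: (@gl3K _ (mx3 1 (- a) (a * c - b) 0 1 (- c) 0 0 1)).
by rewrite mx3M -mx3_1; congr mx3; ring.
Qed.

Lemma diag3E x y z : x != 0 -> y != 0 -> z != 0 ->
  GLval (diag3 x y z) = mx3 x 0 0 0 y 0 0 0 z.
Proof.
move=> x0 y0 z0; apply: (@gl3K _ (mx3 x^-1 0 0 0 y^-1 0 0 0 z^-1)).
by rewrite mx3M -mx3_1; congr mx3; field.
Qed.

Lemma reflE i : GLval (refl i) =
  if i then mx3 1 0 0 0 0 (-1) 0 1 0 else mx3 0 (-1) 0 1 0 0 0 0 1.
Proof.
apply: (@gl3K _ (if i then mx3 1 0 0 0 0 1 0 (-1) 0 else mx3 0 1 0 (-1) 0 0 0 0 1)).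
by case: i; rewrite mx3M -mx3_1; congr mx3; ring.
Qed.

Lemma GL3_eqP (g h : G) : GLval g = GLval h -> g = h.
Proof. exact: val_inj. Qed.

Ltac nonzero := by rewrite ?(mulf_neq0, invr_neq0, oppr_eq0, oner_eq0).
Ltac gl3_calc := apply: GL3_eqP; rewrite !GL3_M ?upperE ?diag3E ?reflE /= ?mx3M;
  try nonzero; congr mx3.

Lemma block_unipotent_mx3 a b c d e f g h i :
  block_unipotent [:: 1; 1; 1]%N (mx3 a b c d e f g h i) =
  [&& a == 1, d == 0, e == 1, g == 0, h == 0 & i == 1].
Proof.
apply/block_unipotentP/and5P => [unip|].
  have entry (r s : nat) (lr : (r < 3)%N) (ls : (s < 3)%N) (le : (s <= r)%N) :
      mx3 a b c d e f g h i (Ordinal lr) (Ordinal ls) = (r == s)%:R.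
    apply: unip; clear -le lr ls.
    by case: r s lr ls le => [|[|[|?]]] // [|[|[|?]]].
  have := (entry 0 0 isT isT isT, entry 1 0 isT isT isT, entry 1 1 isT isT isT,
    entry 2 0 isT isT isT, entry 2 1 isT isT isT, entry 2 2 isT isT isT)%N.
  by rewrite !mxE /=; case=> [[[[[-> ->] ->] ->] ->] ->]; rewrite !eqxx.
case=> /eqP-> /eqP-> /eqP-> /eqP-> /andP[/eqP-> /eqP->] r s.
by move: r s => [[|[|[|?]]] ?] [[|[|[|?]]] ?] //=; rewrite mxE.
Qed.

Lemma tr_mx3 a b c d e f g h i :
  (mx3 a b c d e f g h i)^T = mx3 a d g b e h c f i.
Proof.
apply/matrixP => r s; rewrite !mxE.
by move: r s => [[|[|[|?]]] ?] [[|[|[|?]]] ?].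
Qed.

Lemma upper_in a b c : upper a b c \in U.
Proof. by rewrite inE upperE block_unipotent_mx3 !eqxx. Qed.

Lemma mem_upper (g : G) : g \in U -> exists a b c, g = upper a b c.
Proof.
case: (mx3_eta (GLval g)) => a [b [c [d [e [f [k [h [i gE]]]]]]]].
rewrite inE gE block_unipotent_mx3.
case/and5P=> /eqP a1 /eqP d0 /eqP e1 /eqP k0 /andP[/eqP h0 /eqP i1].
exists b, c, f; apply: GL3_eqP.
by rewrite upperE gE a1 d0 e1 k0 h0 i1.
Qed.

Lemma sum_upper (V : nmodType) (f : G -> V) :
  \sum_(u in U) f u = \sum_a \sum_b \sum_c f (upper a b c).
Proof.
rewrite (pair_bigA _ (fun a b => \sum_c f (upper a b c))) /=.
rewrite (pair_bigA _ (fun p c => f (upper p.1 p.2 c))) /=.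
pose k (p : F * F * F) := upper p.1.1 p.1.2 p.2.
pose k' (g : G) : F * F * F :=
  (GLval g 0 (inord 1), GLval g 0 (inord 2), GLval g (inord 1) (inord 2)).
have kK : cancel k k'.
  move=> [[a b] c]; rewrite /k' /k upperE !mxE /=.
  by rewrite !inordK.
rewrite (reindex_onto k k') /=; last first.
  by move=> g /mem_upper[a [b [c ->]]]; rewrite -[upper a b c]/(k (a, b, c)) kK.
by apply: eq_bigl => p; rewrite upper_in kK eqxx.
Qed.

Lemma card_upper : #|U| = (q ^ 3)%N.
Proof.
rewrite -sum1_card sum_upper.
under eq_bigr => a _ do under eq_bigr => b _ do rewrite sum1_card.
by under eq_bigr => a _ do rewrite sum_nat_const; rewrite sum_nat_const !expnS muln1.
Qed.

Lemma diag3M x y z x' y' z' : x != 0 -> y != 0 -> z != 0 ->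
  x' != 0 -> y' != 0 -> z' != 0 ->
  (diag3 x y z * diag3 x' y' z')%g = diag3 (x * x') (y * y') (z * z').
Proof. by move=> *; gl3_calc; ring. Qed.

Lemma refl_diag3 i x y z : x != 0 -> y != 0 -> z != 0 ->
  (refl i * diag3 x y z)%g =
  ((if i then diag3 x z y else diag3 y x z) * refl i)%g.
Proof. by move=> *; case: i; gl3_calc; ring. Qed.

Lemma diag3_upper (x y z a b c : F) : x != 0 -> y != 0 -> z != 0 ->
  (diag3 x y z * upper a b c)%g =
  (upper (x / y * a) (x / z * b) (y / z * c) * diag3 x y z)%g.
Proof. by move=> x0 y0 z0; gl3_calc; field; rewrite ?x0 ?y0 ?z0. Qed.

(** An element of [U] is a product of an element that conjugation by the i-th
    reflection keeps in [U], which is moved out to the left, and of one of the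
    i-th root subgroup, which conjugation by the inverse of the other reflection
    keeps in [U]. The same factorization, in the other order, serves for
    [refl2_additive]. *)
Lemma refl_additive i : additive_lengths U (refl i) (refl (~~ i)).
Proof.
move=> _ /mem_upper[a [b [c ->]]].
exists (if i then upper (a * c - b) a 0 else upper 0 (- c) b),
  (if i then upper 0 c 0 else upper 0 (- a) 0).
by split; case: i; rewrite ?upper_in //=; gl3_calc; ring.
Qed.

Lemma refl2_additive i :
  additive_lengths U (refl i * refl (~~ i))%g (refl i).
Proof.
move=> _ /mem_upper[a [b [c ->]]].
exists (if i then upper c 0 0 else upper 0 0 a),
  (if i then upper b (- a) 0 else upper 0 c (a * c - b)).
by split; case: i; rewrite ?upper_in //=; gl3_calc; ring.
Qed.

Definition coroot i (x : F) := if i then diag3 1 x^-1 x else diag3 x^-1 x 1.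
Definition coroot3 (x : F) := diag3 x^-1 1 x.

Lemma reflV i : ((refl i)^-1 = coroot i (-1) * refl i)%g.
Proof.
have N1 : -1 != 0 :> F by rewrite oppr_eq0 oner_eq0.
apply: (mulgI (refl i)); rewrite mulgV; apply: GL3_eqP.
rewrite GL3_1 !GL3_M /coroot; case: i; rewrite diag3E ?invr_neq0 ?oner_eq0 // !reflE !mx3M;
  by congr mx3; field.
Qed.

Arguments coroot i x%_R.
Arguments coroot3 x%_R.

Definition root_coord (i : bool) (a c : F) := if i then c else a.
Lemma refl_conj0 i a b c : root_coord i a c = 0 ->
  (refl i * upper a b c * (refl i)^-1)%g \in U.
Proof.
move=> ac0.
suff -> : (refl i * upper a b c * (refl i)^-1)%g =
  if i then upper (- b) a 0 else upper 0 (- c) b by case: i {ac0}; rewrite upper_in.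
apply: (mulIg (refl i)); rewrite mulgKV.
by case: i ac0 => /= ->; gl3_calc; ring.
Qed.

(** The identity of GL_2 that expresses a nontrivial lower unitriangular matrix
    in the big Bruhat cell:
    [[1, 0; d, 1] = [1, d^-1; 0, 1] [d^-1, 0; 0, d] [0, -1; 1, 0] [1, d^-1; 0, 1]].
    The coordinates of [u] outside the root subgroup are moved to the left. *)
Lemma refl_conj i a b c : root_coord i a c != 0 ->
  exists w1 w2, [/\ w1 \in U, w2 \in U &
  (refl i * upper a b c * (refl i)^-1)%g =
    (w1 * (coroot i (- root_coord i a c) * refl i) * w2)%g].
Proof.
move=> ac0; set d := - root_coord i a c.
have d0 : d != 0 by rewrite oppr_eq0.
exists (if i then upper (a * c - b) a 0 * upper 0 0 d^-1
  else upper 0 (- c) b * upper d^-1 0 0)%g,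
  (if i then upper 0 0 d^-1 else upper d^-1 0 0).
split; [by case: (i); rewrite ?groupM ?upper_in..|].
apply: (mulIg (refl i)); rewrite mulgKV /coroot.
by case: i ac0 @d d0 => /= ac0 d0; rewrite -!mulgA; gl3_calc; field.
Qed.

Lemma corootM i x y : x != 0 -> y != 0 ->
  (coroot i x * coroot i y)%g = coroot i (x * y).
Proof.
by move=> x0 y0; case: i; rewrite /coroot diag3M ?invr_neq0 ?oner_eq0 // invfM mulr1.
Qed.

Lemma coroot3M x y : x != 0 -> y != 0 ->
  (coroot3 x * coroot3 y)%g = coroot3 (x * y).
Proof.
by move=> x0 y0; rewrite /coroot3 diag3M ?invr_neq0 ?oner_eq0 // invfM mulr1.
Qed.

Lemma coroot3E i x : x != 0 -> coroot3 x = (coroot i x * coroot (~~ i) x)%g.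
Proof.
by move=> x0; case: i; rewrite /coroot3 /coroot /= diag3M ?invr_neq0 ?oner_eq0 //;
  rewrite ?mulVf ?mulfV // !(mul1r, mulr1).
Qed.

Lemma corootC i j x y : x != 0 -> y != 0 ->
  (coroot i x * coroot j y)%g = (coroot j y * coroot i x)%g.
Proof.
move=> x0 y0; case: i; case: j; rewrite /coroot !diag3M ?invr_neq0 ?oner_eq0 //;
  by congr diag3; rewrite mulrC.
Qed.

Lemma refl_coroot i x : x != 0 ->
  (refl i * coroot i x)%g = (coroot i x^-1 * refl i)%g.
Proof.
by move=> x0; case: i; rewrite /coroot refl_diag3 ?invr_neq0 ?oner_eq0 // invrK.
Qed.

Lemma refl_coroot_other i x : x != 0 ->
  (refl i * coroot (~~ i) x)%g = (coroot3 x * refl i)%g.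
Proof. by move=> x0; case: i; rewrite /coroot refl_diag3 ?invr_neq0 ?oner_eq0. Qed.

Lemma refl_coroot3 i x : x != 0 ->
  (refl i * coroot3 x)%g = (coroot (~~ i) x * refl i)%g.
Proof. by move=> x0; case: i; rewrite /coroot3 refl_diag3 ?invr_neq0 ?oner_eq0. Qed.

Lemma diag3V x y z : x != 0 -> y != 0 -> z != 0 ->
  ((diag3 x y z)^-1 = diag3 x^-1 y^-1 z^-1)%g.
Proof.
move=> x0 y0 z0; apply: (mulgI (diag3 x y z)); rewrite mulgV; apply: GL3_eqP.
rewrite GL3_1 GL3_M !diag3E ?invr_neq0 // mx3M; congr mx3; by field; rewrite ?x0 ?y0 ?z0.
Qed.

Lemma diag3_conj_in x y z (g : G) : x != 0 -> y != 0 -> z != 0 ->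
  g \in U -> (diag3 x y z * g * (diag3 x y z)^-1)%g \in U.
Proof.
by move=> x0 y0 z0 /mem_upper[a [b [c ->]]]; rewrite diag3_upper // mulgK upper_in.
Qed.

Lemma diag3_conj x y z (g : G) : x != 0 -> y != 0 -> z != 0 ->
  (g \in U) = (diag3 x y z * g * (diag3 x y z)^-1 \in U)%g.
Proof.
move=> x0 y0 z0; apply/idP/idP => [|gU]; first exact: diag3_conj_in.
have -> : g = ((diag3 x y z)^-1 * (diag3 x y z * g * (diag3 x y z)^-1) *
    (diag3 x y z)^-1^-1)%g by rewrite invgK !mulgA mulVg mul1g mulgKV.
by rewrite diag3V //; apply: diag3_conj_in; rewrite ?invr_neq0 // -diag3V.
Qed.

Definition long_elt := gl3 (mx3 0 0 1 0 (-1) 0 1 0 0).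

Lemma long_eltE : GLval long_elt = mx3 0 0 1 0 (-1) 0 1 0 0.
Proof.
apply: (@gl3K _ (mx3 0 0 1 0 (-1) 0 1 0 0)).
by rewrite mx3M -mx3_1; congr mx3; ring.
Qed.

Lemma long_elt_refl i : long_elt = (refl i * refl (~~ i) * refl i)%g.
Proof. by case: i; apply: GL3_eqP; rewrite !GL3_M long_eltE !reflE !mx3M; congr mx3; ring. Qed.

Lemma long_diag3 x y z : x != 0 -> y != 0 -> z != 0 ->
  (long_elt * diag3 x y z)%g = (diag3 z y x * long_elt)%g.
Proof.
by move=> x0 y0 z0; apply: GL3_eqP; rewrite !GL3_M long_eltE !diag3E // !mx3M; congr mx3; ring.
Qed.

Lemma long_conj (g : G) : (g \in U) = (long_elt * g * long_elt^-1 \in Uop)%g.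
Proof.
case: (mx3_eta (GLval g)) => a [b [c [d [e [f [k [h [i gE]]]]]]]].
have wgw : GLval (long_elt * g * long_elt^-1)%g = mx3 i (- h) k (- f) e (- d) c (- b) a.
  transitivity (GLval (long_elt * g * long_elt)%g); last first.
    by rewrite !GL3_M long_eltE gE !mx3M; congr mx3; ring.
  congr (GLval (_ * _)%g); apply: (mulIg long_elt); rewrite mulVg; apply: GL3_eqP.
  by rewrite GL3_1 GL3_M long_eltE mx3M; congr mx3; ring.
rewrite !inE wgw gE tr_mx3 !block_unipotent_mx3 !oppr_eq0.
by do 6!case: (_ == _).
Qed.

End GL3.

(** * Identities between products [s * a * s] in a ring *)

Lemma sandwich_move (S : pzRingType) (s a b b' : S) :
  b * s = s * b -> b' * s = s * b' -> a * b = b' * a ->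
  s * a * s * b = b' * (s * a * s).
Proof. by move=> bs bs' ab; rewrite -mulrA -bs mulrA -(mulrA s) ab !mulrA bs'. Qed.

Lemma scale_move (K : fieldType) (A : algType K) (k : K) (a b b' : A) :
  a * b = b' * a -> (k *: a) * b = b' * (k *: a).
Proof. by move=> ab; rewrite -scalerAl ab scalerAr. Qed.

Lemma left_multiple_commutes (S : pzRingType) (d d' z : S) :
  d' = z * d -> d * z = z * d -> d' * d = d * d'.
Proof. by move=> -> dz; rewrite [RHS]mulrA dz. Qed.

Lemma scale_commute (K : fieldType) (A : algType K) (k : K) (a b : A) :
  a * b = b * a -> (k *: a) * (k *: b) = (k *: b) * (k *: a).
Proof. by move=> ab; rewrite -!scalerAl -!scalerAr ab. Qed.

Lemma scale_mul (K : fieldType) (A : algType K) (k l : K) (a b : A) :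
  (k *: a) * (l *: b) = (k * l) *: (a * b).
Proof. by rewrite -scalerAl -scalerAr scalerA. Qed.

Lemma scale_mul3 (K : fieldType) (A : algType K) (k : K) (a b c : A) :
  (k *: a) * (k *: b) * (k *: c) = (k ^+ 3) *: (a * b * c).
Proof. by rewrite !scale_mul -!expr2 -exprSr. Qed.

Lemma sandwich_absorbl (S : pzRingType) (s a : S) :
  s * s = s -> s * (s * a * s) = s * a * s.
Proof. by move=> ss; rewrite !mulrA ss. Qed.

Lemma sandwich_absorbr (S : pzRingType) (s a : S) :
  s * s = s -> (s * a * s) * s = s * a * s.
Proof. by move=> ss; rewrite -mulrA ss. Qed.

Lemma sandwich_conj (S : pzRingType) (s s' a b : S) :
  s * s = s -> a * s = s' * a -> a * b = 1 ->
  (s * a * s) * (s * b * s) = s * s' * s.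
Proof.
move=> ss as' ab; rewrite !mulrA -(mulrA _ s s) ss -(mulrA s a s) as'.
by rewrite !mulrA -(mulrA _ a b) ab mulr1.
Qed.

Lemma conj_commute (S : pzRingType) (w w' s s' d d' : S) :
  w * s = s' * w -> w * w' = 1 -> d * w = w * d' -> d' * s = s * d' ->
  d * s' = s' * d.
Proof.
move=> ws ww dw ds; have s'E : s' = w * s * w' by rewrite ws -mulrA ww mulr1.
rewrite [in LHS]s'E !mulrA dw -(mulrA w) ds mulrA ws -(mulrA s' w) -dw.
by rewrite -!mulrA ww mulr1.
Qed.

Lemma scaled_sandwich_commute (K : fieldType) (A : algType K) (k : K) (s s' d : A) :
  d * s = s * d -> d * s' = s' * d ->
  (k *: (s * s' * s)) * d = d * (k *: (s * s' * s)).
Proof.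
move=> ds ds'; rewrite -scalerAl -scalerAr; congr (_ *: _).
by rewrite -(mulrA _ s d) -ds mulrA -(mulrA s s') -ds' !mulrA ds.
Qed.

(** * The Yokonuma-Hecke relations for GL_3 *)

Section Relations.
Variables (K : numFieldType) (F : finFieldType).
Local Notation G := (GL3 F).
Local Notation A := (group_algebra K G).
Local Notation U := (U F [:: 1; 1; 1]%N : {group G}).
Local Notation Uop := (Uop F [:: 1; 1; 1]%N : {group G}).
Local Notation "\b g" := (galg_basis K g%g : A) (at level 10, g at level 8).
Local Notation e := (averaging_idempotent K U : A).
Local Notation D := (double_coset K U).
Local Notation q := (#|F|%:R : K).
Implicit Types (x y z : F) (f : F -> G) (i : bool).

Lemma card_nonzero : (\sum_(x : F | x != 0%R) 1)%N = #|F|.-1.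
Proof. by rewrite sum1_card (@eq_card _ _ (predC1 0)) // cardC1. Qed.

Lemma q_gt1 : 1 < q. Proof. by rewrite ltr1n finNzRing_gt1. Qed.
Lemma q_neq0 : q != 0. Proof. by rewrite gt_eqF // (lt_trans ltr01 q_gt1). Qed.
Lemma qp1_neq0 : q + 1 != 0.
Proof. by rewrite gt_eqF // addr_gt0 // (lt_trans ltr01 q_gt1). Qed.
Lemma qm1_neq0 : q - 1 != 0. Proof. by rewrite subr_eq0 gt_eqF // q_gt1. Qed.

Definition torus_average f : A := (q - 1)^-1 *: \sum_(x | x != 0) \b (f x).
Local Notation Tav := torus_average.

Lemma torus_average_const (a : A) : (q - 1)^-1 *: (\sum_(x : F | x != 0) a) = a.
Proof.
rewrite big_const_seq iter_addr_0 -sum1_count card_nonzero -scaler_nat scalerA.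
rewrite -subn1 natrB ?mulVf ?scale1r ?qm1_neq0 //.
by rewrite ltnW // finNzRing_gt1.
Qed.

Lemma torus_averageMl (a : A) f : a * Tav f = (q - 1)^-1 *: \sum_(x | x != 0) a * \b (f x).
Proof. by rewrite /Tav -scalerAr mulr_sumr. Qed.

Lemma torus_averageMr (a : A) f : Tav f * a = (q - 1)^-1 *: \sum_(x | x != 0) \b (f x) * a.
Proof. by rewrite /Tav -scalerAl mulr_suml. Qed.

Lemma torus_average_move (a b : A) f g :
  (forall x, x != 0 -> a * \b (f x) = \b (g x) * b) -> a * Tav f = Tav g * b.
Proof.
by move=> fg; rewrite torus_averageMl torus_averageMr; congr (_ *: _); apply: eq_bigr.
Qed.

Lemma torus_average_inv f : Tav (fun x => f x^-1) = Tav f.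
Proof.
rewrite /Tav [in RHS](reindex_inj invr_inj) /=; congr (_ *: _).
by apply: eq_bigl => x; rewrite invr_eq0.
Qed.

Lemma torus_average_eq (a : A) f f' :
  (forall x, x != 0 -> a * \b (f x) = a * \b (f' x)) -> a * Tav f = a * Tav f'.
Proof. by move=> ff'; rewrite !torus_averageMl (eq_bigr _ ff'). Qed.

Definition multiplicative f :=
  forall x y, x != 0 -> y != 0 -> (f x * f y)%g = f (x * y).

Lemma torus_average_basis f y : multiplicative f -> y != 0 -> Tav f * \b (f y) = Tav f.
Proof.
move=> fM y0; rewrite torus_averageMr /Tav; congr (_ *: _).
rewrite [RHS](reindex_inj (mulIf y0)) /=.
apply: eq_big => [x|x x0]; first by rewrite mulf_eq0 (negbTE y0) orbF.
by rewrite -(basisM_eq K (esym (fM x y x0 y0))).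
Qed.

Lemma torus_average_absorb (a : A) f :
  (forall x, x != 0 -> a * \b (f x) = a) -> a * Tav f = a.
Proof.
move=> af; rewrite torus_averageMl -[RHS]torus_average_const; congr (_ *: _).
by apply: eq_bigr.
Qed.

Lemma torus_average_idem f : multiplicative f -> Tav f * Tav f = Tav f.
Proof. by move=> fM; apply: torus_average_absorb => x; apply: torus_average_basis. Qed.

Definition hecke_gen i : A := q *: D (refl F i).
Definition hecke_genV i : A := q *: D (refl F i)^-1%g.
Definition coroot_average i : A := Tav (@coroot F i).
Definition coroot3_average : A := Tav (@coroot3 F).
Local Notation T := hecke_gen.
Local Notation T' := hecke_genV.
Local Notation E := coroot_average.
Local Notation E3 := coroot3_average.

Lemma diag3_average x y z : x != 0 -> y != 0 -> z != 0 ->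
  \b (diag3 x y z) * e = e * \b (diag3 x y z).
Proof. by move=> x0 y0 z0; apply: average_conj => g; apply: diag3_conj. Qed.

Lemma coroot_e i x : x != 0 -> \b (coroot i x) * e = e * \b (coroot i x).
Proof. by move=> x0; case: i; rewrite diag3_average ?invr_neq0 ?oner_eq0. Qed.

Lemma coroot3_e x : x != 0 -> \b (coroot3 x) * e = e * \b (coroot3 x).
Proof. by move=> x0; rewrite diag3_average ?invr_neq0 ?oner_eq0. Qed.

Lemma coroot_average_e i : E i * e = e * E i.
Proof. by symmetry; apply: torus_average_move => x x0; rewrite coroot_e. Qed.

Lemma coroot3_average_e : E3 * e = e * E3.
Proof. by symmetry; apply: torus_average_move => x x0; rewrite coroot3_e. Qed.

Lemma coroot_average_idem i : E i * E i = E i.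
Proof. by apply: torus_average_idem => x y; apply: corootM. Qed.

Lemma coroot3_average_idem : E3 * E3 = E3.
Proof. by apply: torus_average_idem => x y; apply: coroot3M. Qed.

Lemma torus_average_comm f f' :
  (forall x y, x != 0 -> y != 0 -> (f x * f' y)%g = (f' y * f x)%g) ->
  Tav f * Tav f' = Tav f' * Tav f.
Proof.
move=> ff'; apply: torus_average_move => y y0; symmetry.
apply: torus_average_move => x x0.
exact: basis_move (esym (ff' x y x0 y0)).
Qed.

Lemma coroot_averageC i j : E i * E j = E j * E i.
Proof. by apply: torus_average_comm => x y; apply: corootC. Qed.

(** The torus of the highest root is contained in the product of the tori of
    the two simple roots. *)
Lemma coroot_average_mul3 i : E i * E3 = E i * E (~~ i).
Proof.
apply: torus_average_eq => x x0; rewrite (basisM_eq K (coroot3E i x0)) mulrA.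
by rewrite torus_average_basis // => y z; apply: corootM.
Qed.

Lemma coroot3_average_mul i : E3 * E i = E i * E (~~ i).
Proof.
rewrite -coroot_average_mul3; apply: torus_average_comm => x y x0 y0.
by rewrite (coroot3E i x0) -mulgA (corootC _ _ x0 y0) !mulgA (corootC i i x0 y0).
Qed.

Lemma double_coset_move g f f' :
  (forall x, x != 0 -> \b (f x) * e = e * \b (f x)) ->
  (forall x, x != 0 -> \b (f' x) * e = e * \b (f' x)) ->
  (forall x, x != 0 -> (g * f x)%g = (f' x * g)%g) -> D g * Tav f = Tav f' * D g.
Proof.
move=> fe f'e gf; apply: torus_average_move => x x0.
exact: sandwich_move (fe x x0) (f'e x x0) (basis_move K (gf x x0)).
Qed.

Lemma hecke_gen_coroot i : T i * E i = E i * T i.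
Proof.
apply: scale_move; rewrite /coroot_average -[Tav _ in RHS]torus_average_inv.
apply: double_coset_move => x x0.
- exact: coroot_e.
- by apply: coroot_e; rewrite invr_neq0.
- exact: refl_coroot.
Qed.

Lemma hecke_gen_coroot_other i : T i * E (~~ i) = E3 * T i.
Proof.
apply: scale_move; apply: double_coset_move => x x0.
- exact: coroot_e.
- exact: coroot3_e.
- exact: refl_coroot_other.
Qed.

Lemma hecke_gen_coroot3 i : T i * E3 = E (~~ i) * T i.
Proof.
apply: scale_move; apply: double_coset_move => x x0.
- exact: coroot3_e.
- exact: coroot_e.
- exact: refl_coroot3.
Qed.

Lemma N1_neq0 : -1 != 0 :> F. Proof. by rewrite oppr_eq0 oner_eq0. Qed.

Lemma double_coset_coroot i x g : x != 0 ->
  D (coroot i x * g)%g = \b (coroot i x) * D g.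
Proof. by move=> x0; apply: double_coset_mull; apply: coroot_e. Qed.

(** [n_i^-1] and [n_i] differ by the element [coroot i (-1)], which the average
    absorbs. *)
Lemma coroot_hecke_genV i : E i * T' i = E i * T i.
Proof.
rewrite -[LHS]scalerAr -[RHS]scalerAr reflV double_coset_coroot ?N1_neq0 //.
congr (_ *: _); rewrite mulrA torus_average_basis ?N1_neq0 // => x y; exact: corootM.
Qed.

Lemma hecke_genVC i : T' i * T i = T i * T' i.
Proof.
set n := refl F i; set z := \b (coroot i (-1)).
have DV : D n^-1%g = z * D n.
  by rewrite reflV (double_coset_coroot i _ N1_neq0).
have zn : \b n * z = z * \b n.
  by apply: basis_move; rewrite (refl_coroot i N1_neq0) invrN1.
have ze : z * e = e * z := coroot_e i N1_neq0.
have Dz : D n * z = z * D n := sandwich_move ze ze zn.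
have DD : D n^-1%g * D n = D n * D n^-1%g := left_multiple_commutes DV Dz.
exact: scale_commute DD.
Qed.

Lemma card_U : (#|U|%:R : K) = q ^+ 3.
Proof. by rewrite card_upper natrX. Qed.

(** A function of a single coordinate of [U] takes each of its values on [q^2]
    elements. *)
Lemma sum_root_coord i (V : lmodType K) (g : F -> V) :
  \sum_(a : F) \sum_(b : F) \sum_(c : F) g (root_coord i a c) = q ^+ 2 *: \sum_a g a.
Proof.
have qE (v : V) : \sum_(x : F) v = q *: v by rewrite sumr_const scaler_nat.
case: i => /=; first by rewrite !qE scalerA.
under eq_bigr => a _ do under eq_bigr => b _ do rewrite qE.
under eq_bigr => a _ do rewrite qE scalerA.
by rewrite -scaler_sumr.
Qed.

(** Summing over [U], the conjugate of [u] by [n_i] stays in [U] when its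
    coordinate on the i-th simple root is zero, and otherwise lies in the double
    coset of an element of the coroot torus times [n_i]. *)
Lemma hecke_gen_quadratic i : T i * T' i = q *: e + (q - 1) *: (E i * T i).
Proof.
pose n := refl F i.
pose g x : A := if x == 0 then e else \b (coroot i (- x)) * D n.
have Dg a b c : D (n * upper a b c * n^-1)%g = g (root_coord i a c).
  rewrite /g; have [ac0|ac0] := eqVneq.
    by rewrite double_coset_mem // refl_conj0.
  have [w1 [w2 [h1 h2 ->]]] := refl_conj b ac0.
  by rewrite double_coset_shift // double_coset_coroot // oppr_eq0.
have q0 := q_neq0; have q10 := qm1_neq0.
have normalise (x s : A) : (q ^+ 3)^-1 *: (q ^+ 2 *: (x + s)) =
    q^-1 *: x + (q^-1 * (q - 1)) *: ((q - 1)^-1 *: s).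
  by rewrite !scalerDr !scalerA; congr (_ *: _ + _ *: _); field; rewrite ?q0 ?q10.
have rescale (x y : A) : (q * q) *: (q^-1 *: x + (q^-1 * (q - 1)) *: y) =
    q *: x + (q - 1) *: (q *: y).
  by rewrite !scalerDr !scalerA; congr (_ *: _ + _ *: _); field.
have DD : D n * D n^-1%g = q^-1 *: e + (q^-1 * (q - 1)) *: (E i * D n).
  rewrite double_cosetM_sum card_U sum_upper.
  under eq_bigr => a _ do under eq_bigr => b _ do under eq_bigr => c _ do rewrite Dg.
  rewrite sum_root_coord (bigD1 0) //= {1}/g eqxx.
  rewrite (reindex_inj oppr_inj) /= torus_averageMr.
  rewrite (eq_bigl (fun x => x != 0)) => [|x]; last by rewrite oppr_eq0.
  rewrite (eq_bigr (fun x => \b (coroot i x) * D n)) => [|x x0]; last first.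
    by rewrite /g oppr_eq0 (negbTE x0) opprK.
  exact: normalise.
have -> : T i * T' i = (q * q) *: (D n * D n^-1%g) by exact: scale_mul.
rewrite DD rescale; congr (_ + _ *: _).
exact: scalerAr.
Qed.

Lemma double_coset_long i :
  D (refl F i) * D (refl F (~~ i)) * D (refl F i) = D (long_elt F).
Proof.
exact: double_coset_word (@refl_additive F i) (@refl2_additive F i) (long_elt_refl F i).
Qed.

Lemma double_coset_longV i :
  D (refl F i)^-1%g * D (refl F (~~ i))^-1%g * D (refl F i)^-1%g =
  D (long_elt F)^-1%g.
Proof.
exact: double_coset_wordV (@refl_additive F i) (@refl2_additive F i) (long_elt_refl F i).
Qed.

Lemma hecke_gen_long i : T i * T (~~ i) * T i = q ^+ 3 *: D (long_elt F).
Proof. by rewrite -(double_coset_long i); apply: scale_mul3. Qed.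

Lemma hecke_genV_long i : T' i * T' (~~ i) * T' i = q ^+ 3 *: D (long_elt F)^-1%g.
Proof. by rewrite -(double_coset_longV i); apply: scale_mul3. Qed.

Lemma yokonuma_GL3 : yokonuma_relations q e T T' E E3.
Proof.
have ee : e * e = e := average_absorbl K (subxx U).
split; [exact: ee | | | exact: coroot_average_e | exact: coroot3_average_e
  | exact: coroot_average_idem | exact: coroot3_average_idem
  | by move=> i; apply: coroot_averageC | exact: coroot_average_mul3
  | exact: coroot3_average_mul | exact: hecke_gen_coroot
  | exact: hecke_gen_coroot_other | exact: hecke_gen_coroot3
  | exact: coroot_hecke_genV | exact: hecke_gen_quadratic | exact: hecke_genVC | |] => i.
- apply: etrans (esym (scalerAr q e _)) _.
  exact: (congr1 ( *:%R q) (sandwich_absorbl (\b (refl F i)) ee)).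
- apply: etrans (esym (scalerAl q _ e)) _.
  exact: (congr1 ( *:%R q) (sandwich_absorbr (\b (refl F i)) ee)).
- have := hecke_gen_long (~~ i); rewrite negbK => long'.
  exact: etrans (hecke_gen_long i) (esym long').
- have := hecke_genV_long (~~ i); rewrite negbK => long'.
  exact: etrans (hecke_genV_long i) (esym long').
Qed.

Lemma long_average :
  \b (long_elt F) * e = averaging_idempotent K Uop * \b (long_elt F).
Proof. by apply: average_conj => g; apply: long_conj. Qed.

Lemma radon_full_twist : radon_element F K = full_twist T T'.
Proof.
have conj : D (long_elt F) * D (long_elt F)^-1%g = e * averaging_idempotent K Uop * e.
  exact: sandwich_conj (average_absorbl K (subxx U)) long_average (basis_mulV K (long_elt F)).
have cardU2 : #|U|%:R ^+ 2 = q ^+ 3 * q ^+ 3 by rewrite card_U expr2.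
apply: etrans (congr2 *:%R cardU2 (esym conj)) _.
apply: etrans (esym (scale_mul _ _ _ _)) _.
exact: esym (congr2 *%R (hecke_gen_long false) (hecke_genV_long false)).
Qed.

(** Diagonal matrices normalize both [U] and [U^op]; for the latter this is
    transported by the longest element. *)
Lemma radon_diag3 a b c : a != 0 -> b != 0 -> c != 0 ->
  radon_element F K * \b (diag3 a b c) = \b (diag3 a b c) * radon_element F K.
Proof.
move=> a0 b0 c0.
have dw := esym (basis_move K (long_diag3 c0 b0 a0)).
have dop := conj_commute long_average (basis_mulV K (long_elt F)) dw (diag3_average c0 b0 a0).
exact: scaled_sandwich_commute (diag3_average a0 b0 c0) dop.
Qed.

Lemma radon_coroot_average i : radon_element F K * E i = E i * radon_element F K.
Proof.
apply: torus_average_move => x x0.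
by case: i; apply: radon_diag3; rewrite ?invr_neq0 ?oner_eq0.
Qed.

Lemma radon_coroot3_average : radon_element F K * E3 = E3 * radon_element F K.
Proof.
by apply: torus_average_move => x x0; apply: radon_diag3; rewrite ?invr_neq0 ?oner_eq0.
Qed.

(** The Radon element absorbs [e] on the right, so an eigenvector for a nonzero
    eigenvalue is invariant under [U]. *)
Lemma radon_eigenvalue (a : K) (u : A) :
  u != 0 -> a != 0 -> a *: u = u * radon_element F K ->
  a \in [:: 1; q ^+ 2; q ^+ 3; q ^+ 4; q ^+ 6].
Proof.
move=> u0 a0 au.
have Re : radon_element F K * e = radon_element F K.
  have ee : e * e = e := average_absorbl K (subxx U).
  apply: etrans (esym (scalerAl _ _ e)) _.
  exact: (congr1 ( *:%R _) (sandwich_absorbr (averaging_idempotent K Uop) ee)).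
have ue : u * e = u.
  apply: (scalerI a0); apply: etrans (scalerAl a u e) _.
  rewrite au; apply: etrans (esym (mulrA u _ e)) _.
  exact: (congr1 ( *%R u) Re).
apply: (full_twist_spectrum yokonuma_GL3 q_neq0 qp1_neq0 _ _ ue u0).
- by move=> i; have := radon_coroot_average i; rewrite radon_full_twist.
- by have := radon_coroot3_average; rewrite radon_full_twist.
- by rewrite -radon_full_twist.
Qed.

End Relations.

(** * Spaces of invariants and the spectrum *)

Lemma upper_unipotent_sub (F : finFieldType) :
  U F [:: 2; 1]%N \subset U F [:: 1; 1; 1]%N.
Proof.
apply/subsetP => g; rewrite !inE => /block_unipotentP h.
apply/block_unipotentP => r s le_sr; apply: h; move: le_sr.
by move: r s => [[|[|[|?]]] ?] [[|[|[|?]]] ?].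
Qed.

(** When [H] is a subgroup of [G], the average over [G] absorbs the one over [H]
    on both sides. *)
Lemma hecke_algebraS (K : numFieldType) (gT : finGroupType) (G H : {group gT}) :
  H \subset G -> (hecke_algebra K G <= hecke_algebra K H)%VS.
Proof.
move=> sHG.
have sl : (<[averaging_idempotent K G]> <= <[averaging_idempotent K H]> * fullv)%VS.
  by rewrite -memvE -(average_absorbl K sHG) memv_mul ?memv_line ?memvf.
have sr : (<[averaging_idempotent K G]> <= fullv * <[averaging_idempotent K H]>)%VS.
  by rewrite -memvE -(average_absorbr K sHG) memv_mul ?memv_line ?memvf.
apply: subv_trans (prodvS (prodvS sl (subvf _)) sr) _.
rewrite /hecke_algebra -!prodvA prodvSr // !prodvA.
by rewrite prodvSl ?subvf.
Qed.

Lemma invariants_mul_hecke (K : numFieldType) (gT : finGroupType) (H : {group gT})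
    (v x : group_algebra K gT) :
  x \in hecke_algebra K H -> v * x \in invariants K H.
Proof.
move=> xH; apply: (subvP (prodvSl _ (subvf (fullv * (<[averaging_idempotent K H]> * fullv))%VS))).
by rewrite -prodvA memv_mul ?memvf.
Qed.

Lemma leigenvalue_right_action (K : fieldType) (A : falgType K) (W : {vspace A}) (x : A) (a : K) :
  (forall v, v \in W -> v * x \in W) ->
  passmx.leigenvalue (right_action W x) a ->
  exists2 v, v != 0 & a *: v = v * x.
Proof.
move=> Wx; rewrite /passmx.leigenvalue -vpick0; set u := vpick _ => u0.
exists (vsval u); first by apply: contra u0 => /eqP uv; apply/eqP/subvs_inj; rewrite uv linear0.
have: u \in passmx.leigenspace (right_action W x) a by apply: memv_pick.
rewrite memv_ker add_lfunE opp_lfunE scale_lfunE id_lfunE subr_eq0 => /eqP uE.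
by rewrite -right_actionE // uE linearZ.
Qed.

Theorem corollary6p9 (R : realType) (F : finFieldType) :
  let U111 := U F [:: 1; 1; 1]%N in
  let U21 := U F [:: 2; 1]%N in
  let Rad := radon_element F R[i] in
  let W := invariants R[i] U21 in
  let q : R[i] := #|F|%:R in
  [/\ Rad \in hecke_algebra R[i] U111,
      (hecke_algebra R[i] U111 <= hecke_algebra R[i] U21)%VS,
      forall v : group_algebra R[i] {'GL_3[F]}, v \in W -> v * Rad \in W
    & forall a : R[i], passmx.leigenvalue (right_action W Rad) a ->
        a \in [:: 0; 1; q; q ^+ 2; q ^+ 3; q ^+ 4; q ^+ 5; q ^+ 6]].
Proof.
move=> U111 U21 Rad W q.
have sU : U21 \subset U111 := upper_unipotent_sub F.
have RadH : Rad \in hecke_algebra R[i] U111.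
  by apply: memvZ; rewrite !memv_mul ?memv_line ?memvf.
have sH := @hecke_algebraS R[i] _ _ _ sU.
have WRad v : v \in W -> v * Rad \in W.
  by move=> _; apply: invariants_mul_hecke (subvP sH _ RadH).
split => //.
move=> a /(leigenvalue_right_action _)[|v v0 av]; first exact: WRad.
have [->|a0] := eqVneq a 0; first by rewrite !inE eqxx.
have := radon_eigenvalue v0 a0 av.
rewrite -/q !inE => /or4P[|||/orP[]] /eqP->; rewrite eqxx ?orbT //.
Qed.
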